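(* Let $s>0$, $t>1$, and let $x\in(0,1)$ be irrational with continued fraction convergent denominators $(q_k)_{k\ge0}$. Put $$\Sigma_{s,t}(x)=\sum_{k\ge0}\frac{q_{k+1}^{\,t}}{q_k^{\,s}},\qquad \mathcal F_{s,t}(x)=\sum_{n\ge1}\frac{1}{n^{s}|\sin(\pi nx)|^{t}},\qquad \mathcal G_{s,t}(x)=\sum_{n\ge1}\frac{1}{n^{s}\lVert nx\rVert^{t}},$$ as elements of $[0,\infty]$. Then $$\sum_{k\ge1}\frac{q_{k+1}^{\,t}}{q_k^{\,s}}\;\le\;\mathcal G_{s,t}(x)\;\le\;C(s,t)\,\Sigma_{s,t}(x),\qquad C(s,t)=\frac{2^{s+t}\bigl(2+2^{t}\zeta(t)\bigr)}{1-2^{-s}},$$ where $\zeta$ is the Riemann zeta function. In particular, $$\mathcal F_{s,t}(x)<\infty\iff\mathcal G_{s,t}(x)<\infty\iff\Sigma_{s,t}(x)<\infty.$$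
   Context: $\lVert y\rVert=\min_{m\in\mathbb Z}|y-m|$ is the distance from $y\in\mathbb R$ to the nearest integer. For irrational $x\in(0,1)$ write $x=[0;a_1,a_2,\dots]$ for its continued fraction expansion, with convergents $p_k/q_k$; thus $q_{-1}=0$, $q_0=1$, $q_{k+1}=a_{k+1}q_k+q_{k-1}$ for $k\ge0$. *)

(* Defs.v *)
From mathcomp Require Import all_boot all_order all_algebra.
From mathcomp Require Import all_classical all_reals all_analysis.

Set Implicit Arguments.
Unset Strict Implicit.
Unset Printing Implicit Defensive.

Import Order.TTheory GRing.Theory Num.Theory.
Import numFieldNormedType.Exports.

Local Open Scope classical_set_scope.
Local Open Scope ring_scope.

(* The infimum is attained: the set is nonempty and only finitely many
   integers m satisfy `|y - m| <= 1. *)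
Definition dist_int (R : realType) (y : R) : R :=
  inf [set `|y - m%:~R| | m in [set: int]].

(* y |-> 1/y - floor (1/y) for y > 0. *)
Definition gauss_map (R : realType) (y : R) : R :=
  y^-1 - (Num.truncn y^-1)%:R.

(* For x in (0,1) irrational, x = [0; a_1, a_2, ...] with
   a_k = partial_quotient x k for k >= 1. The value at k = 0 is not used. *)
Definition partial_quotient (R : realType) (x : R) (k : nat) : nat :=
  Num.truncn (iter k.-1 (@gauss_map R) x)^-1.

(* q_k; the case k = 1 is q_1 = a_1 q_0 + q_(-1) with q_(-1) = 0. *)
Fixpoint cf_den (R : realType) (x : R) (k : nat) : nat :=
  match k with
  | 0 => 1
  | k1.+1 => partial_quotient x k * cf_den x k1 +
             match k1 with 0 => 0 | k2.+1 => cf_den x k2 end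
  end%N.

Definition zeta (R : realType) (t : R) : R := limn (series (riemannR t)).

Definition Sigma_term (R : realType) (s t x : R) (k : nat) : \bar R :=
  ((cf_den x k.+1)%:R `^ t / (cf_den x k)%:R `^ s)%:E.

Definition Sigma (R : realType) (s t x : R) : \bar R :=
  (\sum_(0 <= k <oo) Sigma_term s t x k)%E.

(* In F_series and G_series no denominator vanishes when x is irrational. *)
Definition F_series (R : realType) (s t x : R) : \bar R :=
  (\sum_(1 <= n <oo)
     (1 / (n%:R `^ s * `|sin (pi * n%:R * x)| `^ t))%R%:E)%E.

Definition G_series (R : realType) (s t x : R) : \bar R :=
  (\sum_(1 <= n <oo) (1 / (n%:R `^ s * dist_int (n%:R * x) `^ t))%R%:E)%E.

Definition Cst (R : realType) (s t : R) : R :=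
  2 `^ (s + t) * (2 + 2 `^ t * zeta t) / (1 - 2 `^ (- s)).

(* Main.v *)
(** Let [g_i] be the orbit of [x] under the Gauss map. By induction
    [q_k x - p_k = (-1)^k E_k] with [E_k = g_0 ... g_k], and
    [q_(k+1) E_k + q_k E_(k+1) = 1], so [1 / (2 q_(k+1)) <= E_k <= 1 / q_(k+1)].
    Lower bound on [G]: keep only the indices [n = q_k], [k >= 1], which are
    distinct. Upper bound: by best approximation, the fractional parts of [n x]
    for [n] in the block [q_k <= n < q_(k+1)] are at distance at least [E_k] from
    [0], from [1] and from each other, so the block contributes at most
    [2 zeta(t) (2 q_(k+1))^t / q_k^s]; the resulting constant [2^(1+t) zeta(t)] is
    smaller than [C(s,t)]. Finally [|sin (pi y)|] lies between [pi / 2] and [pi]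
    times the distance of [y] to the nearest integer. *)

Require Import Defs.
From mathcomp Require Import all_boot all_order all_algebra.
From mathcomp Require Import all_classical all_reals all_analysis.
From mathcomp Require Import ring lra zify.

Set Implicit Arguments.
Unset Strict Implicit.
Unset Printing Implicit Defensive.

Import Order.TTheory GRing.Theory Num.Theory.
Import numFieldNormedType.Exports.

Local Open Scope classical_set_scope.
Local Open Scope ring_scope.

(** * Continued fraction denominators *)

(** A rational value [r] would give [y = 1 / (r + a)] rational, with [a] the integer part of
    [1 / y]. This excludes the value 0, so the expansion never stops. *)
Lemma gauss_map_itv (R : realType) (y : R) :
  0 < y < 1 -> irrational y ->
  0 < gauss_map y < 1 /\ irrational (gauss_map y).
Proof.
move=> /andP[y0 y1] irr_y.
have yV0 : 0 <= y^-1 by rewrite invr_ge0 ltW.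
have /andP[fl_le fl_gt] := truncn_itv yV0.
have irr_g : irrational (gauss_map y).
  move=> [r _ rE]; apply: irr_y; exists (r + (Num.truncn y^-1)%:R)^-1 => //.
  by rewrite fmorphV rmorphD/= ratr_nat rE /gauss_map subrK invrK.
split=> //; apply/andP; split; last first.
  by rewrite /gauss_map ltrBlDr addrC -natr1 in fl_gt *.
rewrite lt0r subr_ge0 fl_le andbT; apply/eqP => g0; apply: irr_g.
by rewrite g0; exists 0 => //; rewrite rmorph0.
Qed.

Definition gauss_orbit (R : realType) (x : R) (k : nat) : R :=
  iter k (@gauss_map R) x.

Lemma gauss_orbit_itv (R : realType) (x : R) (k : nat) :
  0 < x < 1 -> irrational x ->
  0 < gauss_orbit x k < 1 /\ irrational (gauss_orbit x k).
Proof.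
by move=> x01 irr_x; elim: k => [//|k [gk ik]] /=; exact: gauss_map_itv.
Qed.

Lemma gauss_orbitS (R : realType) (x : R) (k : nat) :
  gauss_orbit x k.+1 = (gauss_orbit x k)^-1 - (partial_quotient x k.+1)%:R.
Proof. by []. Qed.

Lemma partial_quotient_gt0 (R : realType) (x : R) (k : nat) :
  0 < x < 1 -> irrational x -> (0 < partial_quotient x k.+1)%N.
Proof.
move=> x01 irr_x; have [/andP[g0 g1] _] := gauss_orbit_itv k x01 irr_x.
by rewrite truncn_gt0 invf_ge1// ltW.
Qed.

Lemma cf_denSS (R : realType) (x : R) (k : nat) :
  cf_den x k.+2 = (partial_quotient x k.+2 * cf_den x k.+1 + cf_den x k)%N.
Proof. by []. Qed.

Lemma cf_den1 (R : realType) (x : R) : cf_den x 1 = partial_quotient x 1.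
Proof. by rewrite /= muln1 addn0. Qed.

Lemma cf_den_gt0 (R : realType) (x : R) (k : nat) :
  0 < x < 1 -> irrational x -> (0 < cf_den x k)%N.
Proof.
move=> x01 irr_x.
suff: (0 < cf_den x k)%N && (0 < cf_den x k.+1)%N by case/andP.
elim: k => [|k /andP[qk qk1]]; first by rewrite cf_den1 partial_quotient_gt0.
by rewrite qk1 cf_denSS addn_gt0 qk orbT.
Qed.

(** Strict growth starts at index 1, because [q_0 = q_1 = 1] when [a_1 = 1]; hence the lower bound
    on [G] leaves out [k = 0]. *)
Lemma cf_den_ltS (R : realType) (x : R) (k : nat) :
  0 < x < 1 -> irrational x -> (cf_den x k.+1 < cf_den x k.+2)%N.
Proof.
move=> x01 irr_x; rewrite cf_denSS.
have := cf_den_gt0 k x01 irr_x; have := partial_quotient_gt0 k.+1 x01 irr_x.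
by case: partial_quotient => // a _ qk; rewrite mulSn -addnA -[ltnLHS]addn0
  ltn_add2l addn_gt0 qk orbT.
Qed.

Lemma cf_den_leS (R : realType) (x : R) (k : nat) :
  0 < x < 1 -> irrational x -> (cf_den x k <= cf_den x k.+1)%N.
Proof.
move=> x01 irr_x; case: k => [|k]; last exact/ltnW/cf_den_ltS.
by rewrite [leqLHS]/= cf_den_gt0.
Qed.

(** Unboundedness of the [q_k] lets the blocks exhaust all [n >= 1]. *)
Lemma cf_den_ge (R : realType) (x : R) (k : nat) :
  0 < x < 1 -> irrational x -> (k <= cf_den x k)%N.
Proof.
move=> x01 irr_x; case: k => [//|k]; elim: k => [|k IHk].
  exact: cf_den_gt0.
exact: leq_ltn_trans IHk (cf_den_ltS _ x01 irr_x).
Qed.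

(* The distance [`|q_k x - p_k|], by [cf_den_approx]. *)
Definition cf_err (R : realType) (x : R) (k : nat) : R :=
  \prod_(i < k.+1) gauss_orbit x i.

Lemma cf_err_gt0 (R : realType) (x : R) (k : nat) :
  0 < x < 1 -> irrational x -> 0 < cf_err x k.
Proof.
move=> x01 irr_x; apply: prodr_gt0 => i _.
by have [/andP[]] := gauss_orbit_itv i x01 irr_x.
Qed.

Lemma cf_errS (R : realType) (x : R) (k : nat) :
  cf_err x k.+1 = cf_err x k * gauss_orbit x k.+1.
Proof. by rewrite /cf_err big_ord_recr. Qed.

Lemma cf_err_leS (R : realType) (x : R) (k : nat) :
  0 < x < 1 -> irrational x -> cf_err x k.+1 <= cf_err x k.
Proof.
move=> x01 irr_x; have [/andP[_ /ltW g1] _] := gauss_orbit_itv k.+1 x01 irr_x.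
by rewrite cf_errS ler_piMr// ltW// cf_err_gt0.
Qed.

(** Substitute [g_(k+2) = 1 / g_(k+1) - a_(k+2)]. Consequently the signed errors [(-1)^k E_k] obey
    the recurrence of the [q_k]. *)
Lemma cf_errSS (R : realType) (x : R) (k : nat) :
  0 < x < 1 -> irrational x ->
  cf_err x k.+2 = cf_err x k - (partial_quotient x k.+2)%:R * cf_err x k.+1.
Proof.
move=> x01 irr_x.
have [/andP[/gt_eqF/negbT g0 _] _] := gauss_orbit_itv k.+1 x01 irr_x.
by rewrite cf_errS gauss_orbitS cf_errS; field.
Qed.

Lemma cf_err1 (R : realType) (x : R) :
  0 < x < 1 -> cf_err x 1 = 1 - (partial_quotient x 1)%:R * x.
Proof.
move=> /andP[/gt_eqF/negbT x0 _].
by rewrite cf_errS gauss_orbitS /cf_err big_ord1 /gauss_orbit/=; field.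
Qed.

Lemma cf_err0 (R : realType) (x : R) : cf_err x 0 = x.
Proof. by rewrite /cf_err big_ord1. Qed.

(** The witness is the numerator [p_k], built from 0 and 1 by its recurrence along an induction on
    two consecutive indices. *)
Lemma cf_den_approx (R : realType) (x : R) (k : nat) :
  0 < x < 1 -> irrational x ->
  exists p : int, (cf_den x k)%:R * x - p%:~R = (-1) ^+ k * cf_err x k.
Proof.
move=> x01 irr_x.
suff [] : (exists p : int, (cf_den x k)%:R * x - p%:~R = (-1) ^+ k * cf_err x k)
  /\ exists p : int, (cf_den x k.+1)%:R * x - p%:~R = (-1) ^+ k.+1 * cf_err x k.+1.
  by [].
elim: k => [|k [[p pE] [p' p'E]]].
  split; first by exists 0; rewrite cf_err0 /=; ring.
  by exists 1; rewrite cf_err1// cf_den1 /=; ring.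
split; first by exists p'.
exists ((partial_quotient x k.+2)%:Z * p' + p).
rewrite cf_errSS// cf_denSS natrD natrM intrD intrM -pmulrn.
rewrite (_ : _ - _ = (partial_quotient x k.+2)%:R *
  ((cf_den x k.+1)%:R * x - p'%:~R) + ((cf_den x k)%:R * x - p%:~R)); last ring.
by rewrite pE p'E !exprS; ring.
Qed.

(** The recurrences of [q] and [E] share the coefficient [a_(k+2)], which cancels, so the left side
    does not depend on [k]. *)
Lemma cf_den_err (R : realType) (x : R) (k : nat) :
  0 < x < 1 -> irrational x ->
  (cf_den x k.+1)%:R * cf_err x k + (cf_den x k)%:R * cf_err x k.+1 = 1.
Proof.
move=> x01 irr_x; elim: k => [|k IHk].
  by rewrite cf_den1 cf_err1// cf_err0 /=; ring.
by rewrite -[RHS]IHk cf_errSS// cf_denSS natrD natrM; ring.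
Qed.

(* Since [p_(k+1) q_k - p_k q_(k+1) = ± 1], [(n, m)] is an integer combination
   [u (q_(k+1), p_(k+1)) + v (q_k, p_k)]; as [0 < n < q_(k+1)], [u] and [v] have
   opposite signs, so the two alternating errors add up. *)
Lemma cf_err_best (R : realType) (x : R) (k n : nat) (m : int) :
  0 < x < 1 -> irrational x -> (0 < n < cf_den x k.+1)%N ->
  cf_err x k <= `|n%:R * x - m%:~R|.
Proof.
move=> x01 irr_x /andP[n0 nq].
have [p pE] := cf_den_approx k x01 irr_x.
have [p' p'E] := cf_den_approx k.+1 x01 irr_x.
have dt := cf_den_err k x01 irr_x.
have E0 := cf_err_gt0 k x01 irr_x; have E'0 := cf_err_gt0 k.+1 x01 irr_x.
have q0 := cf_den_gt0 k x01 irr_x.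
set q := cf_den x k in pE dt q0; set q' := cf_den x k.+1 in p'E dt nq.
set E := cf_err x k in pE dt E0 *; set E' := cf_err x k.+1 in p'E dt E'0.
pose e : int := (-1) ^+ k.
have ee : e * e = 1 by rewrite -expr2 sqrr_sign.
have eR : (-1) ^+ k = e%:~R :> R by rewrite /e rmorphXn/= rmorphN.
rewrite exprS mulN1r eR in p'E; rewrite eR in pE.
have eeR : e%:~R * e%:~R = 1 :> R by rewrite -intrM ee.
(* Writing the numerators through the errors cancels the terms in [x] and leaves [e (q' E + q E')],
   which is [e] by [dt]. *)
have detR : p'%:~R * q%:R - p%:~R * q'%:R = e%:~R :> R.
  have -> : p'%:~R = q'%:R * x - (q'%:R * x - p'%:~R) :> R by ring.
  have -> : p%:~R = q%:R * x - (q%:R * x - p%:~R) :> R by ring.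
  by rewrite pE p'E -[RHS]mulr1 -[X in _ = _ * X]dt; ring.
have det : p' * q%:Z - p * q'%:Z = e.
  by apply: (@intr_inj R); rewrite intrB !intrM -!pmulrn.
pose v := e * (n%:Z * p' - m * q'%:Z); pose u := e * (m * q%:Z - n%:Z * p).
have nE : n%:Z = u * q'%:Z + v * q%:Z.
  by rewrite -[LHS]mulr1 -ee -{2}det /u /v; ring.
have mE : m = u * p' + v * p.
  by rewrite -[LHS]mulr1 -ee -{2}det /u /v; ring.
move: u v nE mE => u v nE mE.
have -> : n%:R * x - m%:~R = e%:~R * (v%:~R * E - u%:~R * E').
  rewrite mE [n%:R]pmulrn nE !intrD !intrM -!pmulrn.
  rewrite (_ : _ - _ = u%:~R * (q'%:R * x - p'%:~R)
    + v%:~R * (q%:R * x - p%:~R)); last ring.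
  by rewrite pE p'E; ring.
have -> : `|e%:~R * (v%:~R * E - u%:~R * E')| = `|v%:~R * E - u%:~R * E'|.
  by rewrite normrM -eR normr_sign mul1r.
(* If [u >= 1], then [n < q'] forces [v <= -1]; if [u <= 0], then [n > 0] forces [v >= 1]. Either
   way the absolute value is at least [|v| E]. *)
have [u1|u0] := leP 1 u.
  have v1 : v <= -1 by nia.
  have {}v1 : v%:~R <= (-1)%:~R :> R by rewrite ler_int.
  have {}u1 : 1%:~R <= u%:~R :> R by rewrite ler_int.
  rewrite -normrN ger0_norm; nra.
have v1 : 1 <= v by nia.
have {}v1 : 1%:~R <= v%:~R :> R by rewrite ler_int.
have {}u0 : u%:~R <= 0%:~R :> R by rewrite ler_int; lia.
rewrite ger0_norm; nra.
Qed.

(** Both terms of [cf_den_err] are at most [q_(k+1) E_k]. *)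
Lemma cf_err_ge (R : realType) (x : R) (k : nat) :
  0 < x < 1 -> irrational x -> (2 * (cf_den x k.+1)%:R)^-1 <= cf_err x k.
Proof.
move=> x01 irr_x; have q'0 := cf_den_gt0 k.+1 x01 irr_x.
rewrite -[leLHS]mul1r ler_pdivrMr; last by rewrite mulr_gt0// ltr0n.
rewrite -[leLHS](cf_den_err k x01 irr_x).
have qq : (cf_den x k)%:R <= (cf_den x k.+1)%:R :> R by rewrite ler_nat cf_den_leS.
have := cf_err_leS k x01 irr_x; have := cf_err_gt0 k.+1 x01 irr_x.
have : 0 <= (cf_den x k)%:R :> R by [].
move: qq; nra.
Qed.

Lemma cf_err_le (R : realType) (x : R) (k : nat) :
  0 < x < 1 -> irrational x -> cf_err x k <= (cf_den x k.+1)%:R^-1.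
Proof.
move=> x01 irr_x; have q'0 := cf_den_gt0 k.+1 x01 irr_x.
rewrite -[leRHS]mul1r ler_pdivlMr ?ltr0n// -[leRHS](cf_den_err k x01 irr_x).
rewrite mulrC lerDl.
by rewrite mulr_ge0// ltW// cf_err_gt0.
Qed.

(** * Zeta and sums over spaced points *)

Lemma powR_inv_le (R : realType) (t a b : R) :
  0 <= t -> 0 < a -> a <= b -> (b `^ t)^-1 <= (a `^ t)^-1.
Proof.
move=> t0 a0 ab; have b0 := lt_le_trans a0 ab.
by rewrite lef_pV2 ?posrE ?powR_gt0// ge0_ler_powR// nnegrE ltW.
Qed.

Lemma powRV (R : realType) (a t : R) : 0 <= a -> a^-1 `^ t = (a `^ t)^-1.
Proof. by move=> a0; rewrite -powR_inv1// -powRrM mulN1r powRN. Qed.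

Lemma powR2_1B (R : realType) (t : R) : 2 `^ (1 - t) = 2 / 2 `^ t :> R.
Proof. by rewrite powRD ?powRr1 ?powRN// pnatr_eq0 implybT. Qed.

Lemma powR_gt2 (R : realType) (t : R) : 1 < t -> 2 < 2 `^ t.
Proof.
move=> t1; have t10 : 0 < t - 1 by rewrite subr_gt0.
have : 1 `^ (t - 1) < 2 `^ (t - 1) :> R by rewrite gt0_ltr_powR ?nnegrE ?ltr1n.
by rewrite powR1 powRB ?pnatr_eq0 ?implybT// powRr1// ltr_pdivlMr ?mul1r.
Qed.

(** As [riemannR t k] is [1 / (k + 1)^t], the terms after the first pair up: [1 / (2 j)^t + 1 / (2 j
    + 1)^t <= 2^(1 - t) / j^t]. *)
Lemma riemannR_sum_double (R : realType) (t : R) (n : nat) : 1 < t ->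
  \sum_(0 <= k < n.*2.+1) riemannR t k
    <= 1 + 2 `^ (1 - t) * \sum_(0 <= k < n) riemannR t k.
Proof.
move=> t1; have t0 : 0 <= t by apply: ltW; apply: lt_trans t1.
elim: n => [|n IHn].
  by rewrite big_nat1 big_geq// mulr0 addr0 /riemannR powR1 invr1.
rewrite doubleS [leLHS]big_nat_recr//= [in leLHS]big_nat_recr//=.
rewrite [in leRHS]big_nat_recr//=.
rewrite mulrDr addrA -addrA lerD//.
have -> : 2 `^ (1 - t) * (n.+1%:R `^ t)^-1 = 2 * ((n.*2.+2)%:R `^ t)^-1.
  by rewrite powR2_1B -mulrA -invfM -powRM// -natrM mul2n.
have : ((n.*2.+3)%:R `^ t)^-1 <= ((n.*2.+2)%:R `^ t)^-1 :> R.
  by rewrite powR_inv_le// ler_nat.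
by rewrite /riemannR; lra.
Qed.

Lemma riemannR_ge0 (R : realType) (t : R) (k : nat) : 0 <= riemannR t k.
Proof. by rewrite invr_ge0 powR_ge0. Qed.

(** With [r = 2^(1 - t) < 1], doubling gives [S_n <= S_(2n+1) <= 1 + r S_n], so the partial sums
    stay below [1 / (1 - r)]. This makes the [limn] in [zeta] a genuine limit. *)
Lemma cvg_riemannR (R : realType) (t : R) : 1 < t -> cvgn (series (riemannR t)).
Proof.
move=> t1.
have r1 : 2 `^ (1 - t) < 1 :> R.
  by rewrite powR2_1B ltr_pdivrMr ?mul1r ?powR_gt2// powR_gt0.
apply: nondecreasing_is_cvgn.
  by apply: nondecreasing_series => k _ _; exact: riemannR_ge0.
exists (1 - 2 `^ (1 - t))^-1 => _ [n _ <-].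
rewrite -[leRHS]mul1r ler_pdivlMr ?subr_gt0// mulrBr mulr1 lerBlDr mulrC.
apply: le_trans (riemannR_sum_double n t1).
apply: (nondecreasing_series (P := xpredT) (m := 0%N)) => [k _ _|].
  exact: riemannR_ge0.
by rewrite -addnn -addnS leq_addr.
Qed.

Lemma riemannR_sum_le_zeta (R : realType) (t : R) (n : nat) :
  1 < t -> \sum_(0 <= k < n) riemannR t k <= zeta t.
Proof.
move=> t1; apply: (nondecreasing_cvgn_le _ (cvg_riemannR t1)).
by apply: nondecreasing_series => k _ _; exact: riemannR_ge0.
Qed.

Lemma zeta_ge1 (R : realType) (t : R) : 1 < t -> 1 <= zeta t.
Proof.
move=> t1; apply: le_trans (riemannR_sum_le_zeta 1 t1).
by rewrite big_nat1 /riemannR powR1 invr1.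
Qed.

(** Meant for the indices of occupied cells, which are distinct but come in no particular order. *)
Lemma ler_sum_uniq_nat (R : numDomainType) (u : nat -> R) (r : seq nat) :
  (forall k, 0 <= u k) -> uniq r ->
  exists n, \sum_(k <- r) u k <= \sum_(0 <= k < n) u k.
Proof.
move=> u0 ur; exists (\max_(k <- r) k).+1.
have rE : perm_eq r [seq k <- index_iota 0 (\max_(k <- r) k).+1 | k \in r].
  apply: uniq_perm => //; first by rewrite filter_uniq// iota_uniq.
  move=> k; rewrite mem_filter; case: (boolP (k \in r)) => //= kr.
  by rewrite mem_index_iota /= ltnS (leq_bigmax_seq (F := id)).
rewrite (perm_big _ rE) big_filter big_mkcond/=; apply: ler_sum => k _.
by case: ifP => // _; exact: u0.
Qed.

(* [f n] lies in the cell of index [truncn (f n / d) >= 1] of width [d], and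
   each cell contains at most one of the [f n]. *)
Lemma sum_spaced_le (R : realType) (t d : R) (f : nat -> R) (a b : nat) :
  1 < t -> 0 < d ->
  (forall n, (a <= n < b)%N -> d <= f n) ->
  (forall m n, (a <= m)%N -> (m < n)%N -> (n < b)%N -> d <= `|f m - f n|) ->
  \sum_(a <= n < b) (f n `^ t)^-1 <= zeta t / d `^ t.
Proof.
move=> t1 d0 df dff; have t0 : 0 <= t by apply: ltW; apply: lt_trans t1.
(* The predecessor matches the shift in [riemannR]: the cell starting at [i d], [i >= 1], gets index
   [i - 1]. *)
pose j n := (Num.truncn (f n / d)).-1.
have jE n : (a <= n < b)%N -> (j n).+1%:R <= f n / d < (j n).+2%:R.
  move=> nab; have fd1 : 1 <= f n / d by rewrite ler_pdivlMr// mul1r df.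
  rewrite prednK ?truncn_gt0//; apply: truncn_itv.
  exact: le_trans fd1.
have uj : uniq [seq j n | n <- index_iota a b].
  rewrite map_inj_in_uniq ?iota_uniq// => m n.
  rewrite !mem_index_iota => mab nab jmn.
  suff neq m' n' : (m' < n')%N -> (a <= m' < b)%N -> (a <= n' < b)%N ->
      j m' = j n' -> False.
    have [mn|nm|//] := ltngtP m n.
      by case: (neq m n).
    by case: (neq n m).
  move=> mn mab' nab' jmn'; have := jE _ mab'; have := jE _ nab'.
  rewrite jmn' !ler_pdivlMr// !ltr_pdivrMr// -!natr1.
  move=> /andP[n1 n2] /andP[m1 m2].
  have /andP[am _] := mab'; have /andP[_ nb] := nab'.
  have := dff _ _ am mn nb; apply/negP; rewrite -ltNge ltr_norml.
  by apply/andP; split; lra.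
have [N jN] := ler_sum_uniq_nat (riemannR_ge0 t) uj.
rewrite ler_pdivlMr ?powR_gt0// mulr_suml.
apply: le_trans (riemannR_sum_le_zeta N t1); apply: le_trans jN.
rewrite big_map; apply: ler_sum_nat => n nab.
have /andP[jn _] := jE _ nab.
rewrite -ler_pdivlMr ?powR_gt0// -invfM -powRM ?(ltW d0)//.
apply: powR_inv_le => //; first by rewrite mulr_gt0.
by rewrite -ler_pdivlMr.
Qed.

(** * Distance to the nearest integer *)

Lemma dist_int_le (R : realType) (y : R) (m : int) : dist_int y <= `|y - m%:~R|.
Proof.
by apply: ge_inf; [exists 0 => _ [k _ <-] | exists m].
Qed.

(** Among integers up to the floor the floor is nearest; among the others, the floor plus 1. *)
Lemma dist_intE (R : realType) (y : R) :
  dist_int y = Num.min (y - (Num.floor y)%:~R) (1 - (y - (Num.floor y)%:~R)).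
Proof.
have /andP[f1 f2] := floor_itv y; rewrite intrD in f2.
apply/eqP; rewrite eq_le; apply/andP; split.
  rewrite le_min; apply/andP; split.
    by apply: le_trans (dist_int_le _ (Num.floor y)) _; rewrite ger0_norm// subr_ge0.
  apply: le_trans (dist_int_le _ (Num.floor y + 1)) _.
  rewrite intrD ler0_norm; lra.
apply: lb_le_inf; first by exists `|y - 0%:~R|; exists 0.
move=> _ [m _ <-]; rewrite ge_min.
have [mf|fm] := leP m (Num.floor y).
  apply/orP; left; apply: le_trans (ler_norm _).
  by rewrite lerB// ler_int.
apply/orP; right; rewrite distrC; apply: le_trans (ler_norm _).
have : (Num.floor y + 1)%:~R <= m%:~R :> R by rewrite ler_int lezD1.
rewrite intrD; lra.
Qed.

Lemma dist_int_itv (R : realType) (y : R) : 0 <= dist_int y <= 2^-1.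
Proof.
have /andP[f1 f2] := floor_itv y; rewrite intrD in f2.
by rewrite dist_intE; case: (leP (y - _) _) => ?; apply/andP; split; lra.
Qed.

(** [|sin (pi y)|] is even and 1-periodic, and [dist_int y] is [y] or [- y] up to an integer; on
    [[0, pi / 2]] the sine is nonnegative. *)
Lemma abs_sin_pi_dist_int (R : realType) (y : R) :
  `|sin (pi * y)| = sin (pi * dist_int y).
Proof.
have sin_shift (r : R) (m : int) : `|sin (pi * (r + m%:~R))| = `|sin (pi * r)|.
  have sin_shift_nat (r' : R) (k : nat) :
      `|sin (pi * (r' + k%:R))| = `|sin (pi * r')|.
    rewrite mulrDr mulr_natr (alternatingn (@sinDpi R)).
    by rewrite normrM normrX normrN1 expr1n mul1r.
  case: m => k; first exact: sin_shift_nat.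
  by rewrite NegzE mulrNz -[in RHS](subrK k.+1%:R r) sin_shift_nat.
have -> : `|sin (pi * y)| = `|sin (pi * dist_int y)|.
  rewrite dist_intE; case: leP => _.
    by rewrite -[RHS](sin_shift _ (Num.floor y)) subrK.
  rewrite -[RHS]normrN -sinN -mulrN -[RHS](sin_shift _ (Num.floor y + 1)).
  by congr (`|sin _|); rewrite intrD; ring.
have /andP[d0 d1] := dist_int_itv y; have p0 := pi_gt0 R.
rewrite ger0_norm// sin_ge0_pi//; apply/andP; split; nra.
Qed.

Lemma sin_mvt (R : realType) (u : R) : 0 <= u ->
  exists2 c, 0 <= c <= u & sin u = cos c * u.
Proof.
move=> u0; have [|c] := MVT_segment u0 (fun x _ => is_derive_sin x).
  exact/continuous_subspaceT/continuous_sin.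
by rewrite in_itv/= sin0 !subr0 => cu; exists c.
Qed.

Lemma sin_le_id (R : realType) (u : R) : 0 <= u -> sin u <= u.
Proof. by move=> u0; have [c _ ->] := sin_mvt u0; rewrite ler_piMl// cos_le1. Qed.

(* [sin (2 v) = 2 sin v cos v], with [cos >= cos (pi / 4)] on [[0, v]]. *)
Lemma sin_ge_half (R : realType) (u : R) : 0 <= u <= pi / 2 -> u / 2 <= sin u.
Proof.
move=> /andP[u0 up]; have v0 : 0 <= u / 2 by rewrite divr_ge0.
have p0 := pi_gt0 R.
(* Since [2 c <= pi / 2], [0 <= cos (2 c) = 2 cos^2 c - 1]. *)
have cos_ge (c : R) : 0 <= c <= u / 2 -> 1 / 2 <= cos c ^+ 2 /\ 0 <= cos c.
  move=> /andP[c0 cu]; split; last by apply: cos_ge0_pihalf; apply/andP; split; lra.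
  have : 0 <= cos (c + c).
    by apply: cos_ge0_pihalf; apply/andP; split; lra.
  by rewrite -mulr2n cos_mulr2n; lra.
have [c cu sE] := sin_mvt v0.
have [c1 c2] := cos_ge _ cu; have [v1 v2] : 1 / 2 <= cos (u / 2) ^+ 2 /\ 0 <= cos (u / 2).
  by apply: cos_ge; rewrite v0 lexx.
have -> : sin u = u * (cos (u / 2) * cos c).
  have -> : sin u = sin ((u / 2) *+ 2) by congr sin; rewrite mulr2n; lra.
  by rewrite sin_mulr2n sE mulr2n; field.
(* Squaring turns [1 / 2 <= cos (u / 2) cos c] into a product of two bounds by [1 / 2]. *)
rewrite ler_wpM2l// -(@ler_pXn2r _ 2)// ?nnegrE ?mulr_ge0//.
rewrite exprMn; nra.
Qed.

(** * Distances from the multiples of [x] to the integers *)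

Lemma cf_err_le_dist_int (R : realType) (x : R) (k n : nat) :
  0 < x < 1 -> irrational x -> (0 < n < cf_den x k.+1)%N ->
  cf_err x k <= dist_int (n%:R * x).
Proof.
move=> x01 irr_x nq; apply: lb_le_inf.
  by exists `|n%:R * x - 0%:~R|; exists 0.
by move=> _ [m _ <-]; exact: cf_err_best.
Qed.

(** Best approximation applies at level [n] because [n < q_(n+1)]. Positivity matters for the lower
    bound on [G]: with [0^-1 = 0], a zero distance would give a zero term. *)
Lemma dist_int_gt0 (R : realType) (x : R) (n : nat) :
  0 < x < 1 -> irrational x -> (0 < n)%N -> 0 < dist_int (n%:R * x).
Proof.
move=> x01 irr_x n0; apply: lt_le_trans (cf_err_gt0 n x01 irr_x) _.
by apply: cf_err_le_dist_int; rewrite // n0; exact: cf_den_ge.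
Qed.

Lemma dist_int_cf_den (R : realType) (x : R) (k : nat) :
  0 < x < 1 -> irrational x ->
  dist_int ((cf_den x k)%:R * x) <= (cf_den x k.+1)%:R^-1.
Proof.
move=> x01 irr_x; have [p pE] := cf_den_approx k x01 irr_x.
apply: le_trans (dist_int_le _ p) _; rewrite pE normrM normr_sign mul1r.
by rewrite gtr0_norm ?cf_err_gt0// cf_err_le.
Qed.

(** * Comparison of the series *)

Definition G_term (R : realType) (s t x : R) (n : nat) : R :=
  1 / (n%:R `^ s * dist_int (n%:R * x) `^ t).

Lemma G_term_ge0 (R : realType) (s t x : R) (n : nat) : 0 <= G_term s t x n.
Proof. by rewrite divr_ge0// mulr_ge0// powR_ge0. Qed.

Definition cf_ratio (R : realType) (s t x : R) (k : nat) : R :=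
  (cf_den x k.+1)%:R `^ t / (cf_den x k)%:R `^ s.

Lemma cf_ratio_ge0 (R : realType) (s t x : R) (k : nat) : 0 <= cf_ratio s t x k.
Proof. by rewrite divr_ge0// powR_ge0. Qed.

Lemma G_term_cf_den_ge (R : realType) (s t x : R) (k : nat) :
  0 < x < 1 -> irrational x -> 0 <= t ->
  cf_ratio s t x k <= G_term s t x (cf_den x k).
Proof.
move=> x01 irr_x t0; have q0 := cf_den_gt0 k x01 irr_x.
have q'0 := cf_den_gt0 k.+1 x01 irr_x.
rewrite /G_term /cf_ratio mul1r invfM mulrC ler_wpM2l ?invr_ge0 ?powR_ge0//.
have := powR_inv_le t0 (dist_int_gt0 x01 irr_x q0) (dist_int_cf_den k x01 irr_x).
by rewrite powRV// invrK.
Qed.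

(** Bounding the inverse power of the minimum by a sum of two lets a block split into two spaced
    families, [r n] and [1 - r n]. *)
Lemma G_term_le (R : realType) (s t x r : R) (k n : nat) :
  0 < x < 1 -> irrational x -> 0 <= s -> (cf_den x k <= n)%N ->
  r = n%:R * x - (Num.floor (n%:R * x))%:~R ->
  G_term s t x n <=
    ((cf_den x k)%:R `^ s)^-1 * ((r `^ t)^-1 + ((1 - r) `^ t)^-1).
Proof.
move=> x01 irr_x s0 qn rE; have q0 := cf_den_gt0 k x01 irr_x.
rewrite /G_term mul1r invfM ler_pM ?invr_ge0 ?powR_ge0//.
  by rewrite powR_inv_le// ?ltr0n// ler_nat.
rewrite dist_intE -rE; case: (leP r (1 - r)) => _.
  by rewrite lerDl invr_ge0 powR_ge0.
by rewrite lerDr invr_ge0 powR_ge0.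
Qed.

Lemma G_block_le (R : realType) (s t x : R) (k : nat) :
  0 < x < 1 -> irrational x -> 0 <= s -> 1 < t ->
  \sum_(cf_den x k <= n < cf_den x k.+1) G_term s t x n
    <= 2 `^ (1 + t) * zeta t * cf_ratio s t x k.
Proof.
move=> x01 irr_x s0 t1.
have q0 := cf_den_gt0 k x01 irr_x; have q'0 := cf_den_gt0 k.+1 x01 irr_x.
pose r n := n%:R * x - (Num.floor (n%:R * x))%:~R.
(* This explicit lower bound for [E_k] yields [1 / d^t = (2 q_(k+1))^t]. *)
pose d : R := (2 * (cf_den x k.+1)%:R)^-1.
have d0 : 0 < d by rewrite invr_gt0 mulr_gt0// ltr0n.
have dE : d <= cf_err x k by exact: cf_err_ge.
have ddist n : (cf_den x k <= n < cf_den x k.+1)%N -> d <= dist_int (n%:R * x).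
  move=> /andP[qn nq]; apply: le_trans dE _; apply: cf_err_le_dist_int => //.
  by rewrite nq (leq_trans q0).
have dr n : (cf_den x k <= n < cf_den x k.+1)%N -> d <= r n /\ d <= 1 - r n.
  by move=> /ddist; rewrite dist_intE le_min => /andP[].
have drr m n : (cf_den x k <= m)%N -> (m < n)%N -> (n < cf_den x k.+1)%N ->
    d <= `|r m - r n|.
  move=> qm mn nq; apply: le_trans dE _.
  (* Up to sign this is [(n - m) x] minus an integer with [0 < n - m < q_(k+1)], so best
     approximation applies again. *)
  have -> : r m - r n = - ((n - m)%:R * x -
      (Num.floor (n%:R * x) - Num.floor (m%:R * x))%:~R).
    by rewrite /r natrB ?(ltnW mn)// intrB; ring.
  rewrite normrN; apply: cf_err_best => //.
  by rewrite subn_gt0 mn (leq_ltn_trans (leq_subr _ _) nq).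
have S1 := sum_spaced_le t1 d0 (fun n nab => (dr n nab).1) drr.
have {}drr m n : (cf_den x k <= m)%N -> (m < n)%N -> (n < cf_den x k.+1)%N ->
    d <= `|(1 - r m) - (1 - r n)|.
  move=> qm mn nq; rewrite (_ : _ - _ = - (r m - r n)); last ring.
  by rewrite normrN drr.
have S2 := sum_spaced_le t1 d0 (fun n nab => (dr n nab).2) drr.
pose c := ((cf_den x k)%:R `^ s)^-1 : R.
apply: (@le_trans _ _ (\sum_(cf_den x k <= n < cf_den x k.+1)
    c * ((r n `^ t)^-1 + ((1 - r n) `^ t)^-1))).
  by apply: ler_sum_nat => n /andP[qn _]; exact: G_term_le.
rewrite -mulr_sumr big_split/=.
have -> : 2 `^ (1 + t) * zeta t * cf_ratio s t x k =
    c * (zeta t / d `^ t + zeta t / d `^ t).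
  have -> : (d `^ t)^-1 = 2 `^ t * (cf_den x k.+1)%:R `^ t.
    by rewrite -powRM// powRV// invrK.
  by rewrite powRD ?pnatr_eq0 ?implybT// powRr1// /cf_ratio -/c; ring.
by rewrite ler_wpM2l ?lerD// invr_ge0 powR_ge0.
Qed.

(** * Sums over blocks and series with nonnegative terms *)

Lemma sum_blocks (V : nmodType) (q : nat -> nat) (u : nat -> V) (m n : nat) :
  (forall k, (q k <= q k.+1)%N) -> (m <= n)%N ->
  \sum_(q m <= i < q n) u i = \sum_(m <= k < n) \sum_(q k <= i < q k.+1) u i.
Proof.
move=> q_le; elim: n => [|n IHn] mn.
  by move: mn; rewrite leqn0 => /eqP->; rewrite !big_geq.
move: mn; rewrite leq_eqVlt => /predU1P[->|]; first by rewrite !big_geq.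
rewrite ltnS => mn; rewrite big_nat_recr//= -IHn//.
apply: big_cat_nat => //.
by apply: (@homo_leq _ q (fun a b => a <= b)%N) => //; exact: leq_trans.
Qed.

Lemma nneseries_EFin_le (R : realType) (u : nat -> R) (m : nat) (c : \bar R) :
  (forall n, 0 <= u n) ->
  (forall n, ((\sum_(m <= k < n) u k)%:E <= c)%E) ->
  (\sum_(m <= k <oo) (u k)%:E <= c)%E.
Proof.
move=> u0 uc; apply: lime_le.
  by apply: is_cvg_nneseries => k _ _; rewrite lee_fin.
by near=> n; rewrite sumEFin.
Unshelve. all: by end_near. Qed.

Lemma nneseries_EFin_ge (R : realType) (u : nat -> R) (m n : nat) :
  (forall n, 0 <= u n) ->
  ((\sum_(m <= k < n) u k)%:E <= \sum_(m <= k <oo) (u k)%:E)%E.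
Proof.
by move=> u0; rewrite -sumEFin; apply: nneseries_lim_ge => k _ _; rewrite lee_fin.
Qed.

Lemma nneseries_EFin_lty (R : realType) (u v : nat -> R) (m : nat) (c : R) :
  (forall n, 0 <= u n) -> (forall n, u n <= c * v n) -> (forall n, 0 <= v n) ->
  0 <= c -> (\sum_(m <= k <oo) (v k)%:E < +oo)%E ->
  (\sum_(m <= k <oo) (u k)%:E < +oo)%E.
Proof.
move=> u0 uv v0 c0 v_fin.
apply: (@le_lt_trans _ _ (c%:E * \sum_(m <= k <oo) (v k)%:E)%E); last first.
  by rewrite lte_mul_pinfty.
apply: nneseries_EFin_le => // n.
apply: le_trans (lee_wpmul2l _ (nneseries_EFin_ge m n v0)); rewrite ?lee_fin//.
by rewrite mulr_sumr ler_sum.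
Qed.

(** When [a = 0], the two bounds force [b = 0] and both sides are 0 by the convention on inverses;
    the termwise comparison thus covers index 0 too. *)
Lemma powR_inv_comparable (R : realType) (t a b c e : R) :
  0 < t -> 0 <= a -> 0 < c -> c * a <= b -> b <= e * a ->
  (b `^ t)^-1 <= (c `^ t)^-1 * (a `^ t)^-1.
Proof.
move=> t0 a0 c0 cab bea; have [aE|aN0] := eqVneq a 0.
  have -> : b = 0.
    by apply/eqP; rewrite eq_le; move: cab bea; rewrite aE !mulr0 => -> ->.
  by rewrite aE powR0 ?gt_eqF// invr0 mulr0.
rewrite -invfM -powRM ?(ltW c0)//; apply: powR_inv_le => //; first exact: ltW.
by rewrite mulr_gt0// lt0r aN0.
Qed.

(** * Termwise comparison of the sine series with [G] *)

Definition F_term (R : realType) (s t x : R) (n : nat) : R :=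
  1 / (n%:R `^ s * `|sin (pi * n%:R * x)| `^ t).

Lemma F_term_ge0 (R : realType) (s t x : R) (n : nat) : 0 <= F_term s t x n.
Proof. by rewrite divr_ge0// mulr_ge0// powR_ge0. Qed.

Lemma abs_sin_pi_bounds (R : realType) (y : R) :
  pi / 2 * dist_int y <= `|sin (pi * y)| <= pi * dist_int y.
Proof.
have p0 := pi_gt0 R; have /andP[d0 d1] := dist_int_itv y.
rewrite abs_sin_pi_dist_int sin_le_id ?mulr_ge0 ?(ltW p0)// andbT mulrAC.
by apply: sin_ge_half; apply/andP; split; nra.
Qed.

Lemma F_term_le (R : realType) (s t x : R) (n : nat) : 0 < t ->
  F_term s t x n <= ((pi / 2) `^ t)^-1 * G_term s t x n.
Proof.
move=> t0; have p0 := pi_gt0 R; rewrite /F_term /G_term !mul1r !invfM -mulrA.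
have /andP[S1 S2] := abs_sin_pi_bounds (n%:R * x).
rewrite [leRHS]mulrCA ler_wpM2l ?invr_ge0 ?powR_ge0//.
apply: powR_inv_comparable S1 S2 => //; last by rewrite divr_gt0.
by have /andP[] := dist_int_itv (n%:R * x).
Qed.

Lemma G_term_le_F_term (R : realType) (s t x : R) (n : nat) : 0 < t ->
  G_term s t x n <= (pi^-1 `^ t)^-1 * F_term s t x n.
Proof.
move=> t0; have p0 := pi_gt0 R; rewrite /F_term /G_term !mul1r !invfM -mulrA.
have /andP[S1 S2] := abs_sin_pi_bounds (n%:R * x).
rewrite [leRHS]mulrCA ler_wpM2l ?invr_ge0 ?powR_ge0//.
(* [S2] divided by [pi] gives the lower bound on the distance, and [S1] the upper bound with factor
   [2 / pi]. *)
apply: (@powR_inv_comparable _ _ _ _ _ (2 / pi)); rewrite ?invr_gt0//.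
  by rewrite [leLHS]mulrC ler_pdivrMr// [leRHS]mulrC.
have -> : 2 / pi = (pi / 2)^-1 :> R by rewrite invf_div.
by rewrite [leRHS]mulrC ler_pdivlMr ?divr_gt0// [leLHS]mulrC.
Qed.

(** * The constant and the final assembly *)

Lemma Cst_ge (R : realType) (s t : R) : 0 < s -> 1 < t ->
  2 `^ (1 + t) * zeta t <= Cst s t.
Proof.
move=> s0 t1; have z1 := zeta_ge1 t1; have t2 := powR_gt2 t1.
have s1 : 1 < 2 `^ s :> R.
  have : 1 `^ s < 2 `^ s :> R by rewrite gt0_ltr_powR ?nnegrE ?ltr1n.
  by rewrite powR1.
have sV : 0 < (2 : R) `^ (- s) < 1.
  by rewrite powRN invr_gt0 invf_lt1 ?(lt_trans ltr01)// s1 (lt_trans ltr01).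
rewrite /Cst !powRD ?pnatr_eq0 ?implybT// powRr1//.
(* The chain is [2 b z (1 - c) <= 2 b z <= b (2 + b z) <= a b (2 + b z)], using [b > 2] and
   [a > 1]. *)
move: (2 `^ s) (2 `^ t) (2 `^ (- s)) (zeta t) s1 t2 sV z1.
move=> a b c z a1 b2 /andP[c0 c1] z1.
have bz : 2 * z <= b * z by nra.
rewrite ler_pdivlMr ?subr_gt0//.
apply: (@le_trans _ _ (2 * b * z)).
  by rewrite ler_piMr; nra.
apply: (@le_trans _ _ (b * (2 + b * z))); first by nra.
by rewrite -mulrA ler_peMl; nra.
Qed.

Theorem proposition3p1 (R : realType) (s t x : R)
  (hs : 0 < s) (ht : 1 < t) (hx0 : 0 < x) (hx1 : x < 1)
  (hx : irrational x) :
  [/\ (\sum_(1 <= k <oo) Sigma_term s t x k <= G_series s t x)%E,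
      (G_series s t x <= (Cst s t)%:E * Sigma s t x)%E,
      (F_series s t x < +oo)%E <-> (G_series s t x < +oo)%E &
      (G_series s t x < +oo)%E <-> (Sigma s t x < +oo)%E].
Proof.
have x01 : 0 < x < 1 by rewrite hx0.
have t0 : 0 < t by exact: lt_trans ht.
have q_le k := cf_den_leS k x01 hx.
have Gge0 := G_term_ge0 s t x; have qge0 := cf_ratio_ge0 s t x.
have Cge0 : 0 <= Cst s t.
  apply: le_trans (Cst_ge hs ht); rewrite mulr_ge0 ?powR_ge0//.
  exact: le_trans (zeta_ge1 ht).
have lower : (\sum_(1 <= k <oo) Sigma_term s t x k <= G_series s t x)%E.
  apply: (nneseries_EFin_le (u := cf_ratio s t x)) => // n.
  apply: le_trans (nneseries_EFin_ge 1 (cf_den x n) Gge0); rewrite lee_fin.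
  have [n0|n0] := posnP n; first by rewrite n0 big_geq// sumr_ge0.
  (* The index 1 is [q_0], so the range is a union of blocks; block 0 is discarded by
     nonnegativity. *)
  rewrite -[1%N in leRHS]/(cf_den x 0) (sum_blocks _ q_le)// [leRHS]big_ltn//.
  rewrite -[leLHS]add0r lerD ?sumr_ge0//; apply: ler_sum_nat => k /andP[k1 _].
  (* Only the first index [q_k] of the block is kept; the block is nonempty as [k >= 1]. *)
  apply: le_trans (G_term_cf_den_ge s k x01 hx (ltW t0)) _.
  rewrite big_ltn ?lerDl ?sumr_ge0//.
  by case: k k1 => // k _; exact: cf_den_ltS.
have upper : (G_series s t x <= (Cst s t)%:E * Sigma s t x)%E.
  apply: (nneseries_EFin_le (u := G_term s t x)) => // n.
  apply: le_trans (lee_wpmul2l _ (nneseries_EFin_ge 0 n qge0)); rewrite ?lee_fin//.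
  (* As [n <= q_n], the partial sum can be extended to end at a block boundary. *)
  apply: (@le_trans _ _ (\sum_(1 <= k < cf_den x n) G_term s t x k)).
    apply: (nondecreasing_series (P := xpredT)) => //.
    exact: cf_den_ge.
  rewrite -[1%N in leLHS]/(cf_den x 0) (sum_blocks _ q_le)// mulr_sumr.
  apply: ler_sum_nat => k _; apply: le_trans (G_block_le k x01 hx (ltW hs) ht) _.
  by rewrite ler_wpM2r// Cst_ge.
split=> //; split.
- apply: (@nneseries_EFin_lty _ (G_term s t x) (F_term s t x) _ (pi^-1 `^ t)^-1) => //.
  + by move=> n; exact: G_term_le_F_term.
  + exact: F_term_ge0.
  + by rewrite invr_ge0 powR_ge0.
- apply: (@nneseries_EFin_lty _ (F_term s t x) (G_term s t x) _ ((pi / 2) `^ t)^-1) => //.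
  + exact: F_term_ge0.
  + by move=> n; exact: F_term_le.
  + by rewrite invr_ge0 powR_ge0.
(* The lower bound starts at [k = 1]; the remaining term [k = 0] is a real number, hence finite. *)
- move=> G_fin; rewrite /Sigma (nneseries_split 0 1); last first.
    by move=> k _; rewrite lee_fin; exact: qge0.
  by rewrite big_nat1 lte_add_pinfty ?ltry// (le_lt_trans lower).
- move=> Sigma_fin; apply: le_lt_trans upper _.
  rewrite lte_mul_pinfty//.
Qed.
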